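(* For all integers $m\ge 0$ and $n\ge 1$, $$s_{((2m+1)^n)}(x_1,x_1^{-1},\dots,x_n,x_n^{-1})+s_{((2m+1)^{n-1})}(x_1,x_1^{-1},\dots,x_n,x_n^{-1})=(-1)^{mn}\,\mathrm{so}_{((m+1)^n)}(x_1,\dots,x_n)\;\mathrm{so}_{(m^n)}(-x_1,\dots,-x_n),$$ as an identity of Laurent polynomials in the indeterminates $x_1,\dots,x_n$.
   Context: For integers $M,k\ge 0$, $(M^k)$ denotes the sequence $(M,M,\dots,M)$ with $k$ entries; a partition is padded with zeros to the number of variables when needed. Schur function: for a partition $\lambda=(\lambda_1\ge\dots\ge\lambda_N\ge 0)$, $$s_\lambda(x_1,\dots,x_N)=\frac{\det_{1\le h,t\le N}\left(x_h^{\lambda_t+N-t}\right)}{\det_{1\le h,t\le N}\left(x_h^{N-t}\right)}.$$ It is a polynomial in $x_1,\dots,x_N$. On the left-hand side of the claim both Schur functions are taken in $2n$ variables ($N=2n$), specialized to $x_1,x_1^{-1},\dots,x_n,x_n^{-1}$. Odd orthogonal character: for a non-increasing sequence $\lambda=(\lambda_1,\dots,\lambda_N)$ of non-negative integers, $$\mathrm{so}_\lambda(x_1,\dots,x_N)=\frac{\det_{1\le h,t\le N}\left(x_h^{\lambda_t+N-t+\frac12}-x_h^{-(\lambda_t+N-t+\frac12)}\right)}{\det_{1\le h,t\le N}\left(x_h^{N-t+\frac12}-x_h^{-(N-t+\frac12)}\right)}.$$ It is a Laurent polynomial in $x_1,\dots,x_N$; $\mathrm{so}_\lambda(-x_1,\dots,-x_N)$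 denotes the result of substituting $-x_i$ for $x_i$ in this Laurent polynomial. *)

(* Defs.v *)
From HB Require Import structures.
From mathcomp Require Import all_boot all_order all_fingroup all_algebra.
From mathcomp Require Import ring.
From mathcomp Require Export mpoly.

Set Implicit Arguments.
Unset Strict Implicit.
Unset Printing Implicit Defensive.

Import GRing.Theory.
Local Open Scope ring_scope.

(* The field Q(x_1, ..., x_n) of rational functions, in which identities of   *)
(* Laurent polynomials with integer coefficients are stated.                  *)
Notation ratfun n := {fraction {mpoly int[n]}}.

Definition var {n : nat} (i : 'I_n) : ratfun n := tofrac ('X_i : {mpoly int[n]}).

Definition peval (F : fieldType) (n : nat) (p : {mpoly int[n]}) (v : 'I_n -> F) : F :=
  mmap intr v p.

(* The pair (p, e) stands for the Laurent polynomial p / x^e.  This writing   *)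
(* is not unique, but the values at points with nonzero coordinates do not    *)
(* depend on it.                                                              *)
Notation laurent n := ({mpoly int[n]} * 'X_{1..n})%type.

Definition leval (F : fieldType) (n : nat) (P : laurent n) (v : 'I_n -> F) : F :=
  peval P.1 v / mmap1 v P.2.

(* Determinants are indexed from 0, so that N - t becomes N - t.+1.           *)
Definition alternant (R : comNzRingType) (N : nat) (lam : 'I_N -> nat) (x : 'I_N -> R) : R :=
  \det (\matrix_(h < N, t < N) x h ^+ (lam t + (N - t.+1))).

(* Here y h stands for x_h^(1/2), and x_h^(l + 1/2) is y h ^+ (2 * l + 1).    *)
Definition so_alternant (F : fieldType) (N : nat) (lam : 'I_N -> nat) (y : 'I_N -> F) : F :=
  \det (\matrix_(h < N, t < N)
     (y h ^+ (2 * (lam t + (N - t.+1)) + 1) - y h ^- (2 * (lam t + (N - t.+1)) + 1))).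

Lemma alternant0_neq0 (F : fieldType) (N : nat) (x : 'I_N -> F) :
  injective x -> alternant (fun=> 0%N) x != 0.
Proof.
move=> x_inj; pose V := Vandermonde N (\row_h x h).
have -> : alternant (fun=> 0%N) x = \det (row_perm (perm rev_ord_inj) V)^T.
  by congr (\det _); apply/matrixP => h t; rewrite !mxE permE.
rewrite det_tr row_permE det_mulmx det_perm mulf_neq0 ?signr_eq0 //.
rewrite det_Vandermonde; apply/prodf_neq0 => i _; apply/prodf_neq0 => j lt_ij.
by rewrite !mxE subr_eq0 (inj_eq x_inj) -(inj_eq val_inj) gtn_eqF.
Qed.

Lemma monom_eq (n : nat) (e e' : 'X_{1..n}) :
  (tofrac 'X_[e] == tofrac ('X_[e'] : {mpoly int[n]})) = (e == e').
Proof.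
rewrite tofrac_eq; apply/eqP/eqP => [E|-> //].
have := congr1 (fun p => e \in msupp p) E.
by rewrite !msuppX !inE eqxx => /esym/eqP.
Qed.

Lemma var_inj (n : nat) : injective (@var n).
Proof. by move=> i j /eqP; rewrite monom_eq eq_mnm1 => /eqP. Qed.

Lemma monic_prod_XsubC_ord (R : comNzRingType) (N : nat) (x : 'I_N -> R) :
  \prod_(h < N) ('X - (x h)%:P) \is monic.
Proof. by apply: monic_prod => h _; exact: monicXsubC. Qed.

Lemma det_horner_small (R : comNzRingType) (N : nat) (x : 'I_N -> R)
    (q : 'I_N -> {poly R}) :
  (forall t, (size (q t) <= N)%N) ->
  \det (\matrix_(h < N, t < N) (q t).[x h]) =
  alternant (fun=> 0%N) x * \det (\matrix_(i < N, t < N) (q t)`_(N - i.+1)).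
Proof.
move=> sq; rewrite /alternant -det_mulmx; congr (\det _).
apply/matrixP => h t; rewrite !mxE (horner_coef_wide _ (sq t)).
rewrite (reindex_inj rev_ord_inj); apply: eq_bigr => i _.
by rewrite !mxE add0n mulrC.
Qed.

Lemma det_horner (R : comNzRingType) (N : nat) (x : 'I_N -> R) (q : 'I_N -> {poly R}) :
  exists c, \det (\matrix_(h < N, t < N) (q t).[x h]) = alternant (fun=> 0%N) x * c.
Proof.
pose d := \prod_(h < N) ('X - (x h)%:P).
have md : d \is monic by exact: monic_prod_XsubC_ord.
have sd : size d = N.+1 by rewrite size_prod_XsubC /index_enum -enumT size_enum_ord.
have dx h : d.[x h] = 0.
  by rewrite /d horner_prod (bigD1 h) //= !hornerE subrr mul0r.
have qx t h : (q t).[x h] = (Pdiv.Ring.rmodp (q t) d).[x h].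
  by rewrite {1}(Pdiv.RingMonic.rdivp_eq md (q t)) !hornerE dx mulr0 add0r.
exists (\det (\matrix_(i < N, t < N) (Pdiv.Ring.rmodp (q t) d)`_(N - i.+1))).
rewrite -det_horner_small => [|t].
  by congr (\det _); apply/matrixP => h t; rewrite !mxE qx.
by rewrite -ltnS -sd Pdiv.Ring.ltn_rmodpN0 // monic_neq0.
Qed.

Lemma schur_exists (N : nat) (lam : 'I_N -> nat) :
  exists p : {mpoly int[N]},
    tofrac p == alternant lam (@var N) / alternant (fun=> 0%N) (@var N).
Proof.
have tf l : alternant l (@var N) = tofrac (alternant l (fun i => 'X_i : {mpoly int[N]})).
  rewrite /alternant -det_map_mx; congr (\det _).
  by apply/matrixP => h t; rewrite !mxE rmorphXn.
have [c Dc] := det_horner (fun i => 'X_i : {mpoly int[N]})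
                 (fun t => 'X^(lam t + (N - t.+1))).
have {}Dc : alternant lam (fun i => 'X_i : {mpoly int[N]}) =
            alternant (fun=> 0%N) (fun i => 'X_i : {mpoly int[N]}) * c.
  by rewrite -Dc; congr (\det _); apply/matrixP => h t; rewrite !mxE hornerXn.
rewrite !tf Dc rmorphM /=.
have nz := alternant0_neq0 (@var_inj N).
by exists c; rewrite mulrC mulKf // -tf.
Qed.

Definition schur (N : nat) (lam : 'I_N -> nat) : {mpoly int[N]} :=
  xchoose (schur_exists lam).

Lemma schurE (N : nat) (lam : 'I_N -> nat) :
  tofrac (schur lam) = alternant lam (@var N) / alternant (fun=> 0%N) (@var N).
Proof. exact/eqP/(xchooseP (schur_exists lam)). Qed.

(* With z = y^2 + y^-2, so_poly l is the polynomial in z equal to             *)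
(* (y^(2l+1) - y^-(2l+1)) / (y - y^-1).                                       *)
Fixpoint so_poly2 (R : comNzRingType) (l : nat) : {poly R} * {poly R} :=
  if l is l'.+1 then
    let: (a, b) := so_poly2 R l' in (b, 'X * b - a)
  else (1, 'X + 1).

Definition so_poly (R : comNzRingType) (l : nat) : {poly R} := (so_poly2 R l).1.

Lemma so_polySS (R : comNzRingType) (l : nat) :
  so_poly R l.+2 = 'X * so_poly R l.+1 - so_poly R l.
Proof. by rewrite /so_poly /=; case: (so_poly2 R l). Qed.

Lemma so_poly1 (R : comNzRingType) : so_poly R 1 = 'X + 1.
Proof. by []. Qed.

Lemma so_poly_ind (P : nat -> Prop) :
  P 0%N -> P 1%N -> (forall l, P l -> P l.+1 -> P l.+2) -> forall l, P l.
Proof.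
move=> P0 P1 PSS l; suff: P l /\ P l.+1 by case.
by elim: l => // l [IH1 IH2]; split=> //; exact: PSS.
Qed.

Lemma so_polyE (F : fieldType) (y : F) (l : nat) : y != 0 ->
  y ^+ (2 * l + 1) - y ^- (2 * l + 1) =
  (y - y^-1) * (so_poly F l).[y ^+ 2 + (y ^+ 2)^-1].
Proof.
move=> y0; elim/so_poly_ind: l => [||l IH1 IH2].
- by rewrite /so_poly muln0 add0n !expr1 hornerC mulr1.
- by rewrite so_poly1 !hornerE; field.
rewrite so_polySS !hornerE mulrBr mulrCA -IH2 -IH1.
have -> : (2 * l.+1 + 1 = (2 * l + 1).+2)%N by ring.
have -> : (2 * l.+2 + 1 = (2 * l + 1).+4)%N by ring.
move: (2 * l + 1)%N => k; rewrite !exprS !invfM.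
have : y ^+ k != 0 by rewrite expf_neq0.
by move: (y ^+ k) => w w0; field; rewrite w0 y0 oner_eq0.
Qed.

Lemma size_so_poly (R : comNzRingType) (l : nat) : size (so_poly R l) = l.+1.
Proof.
elim/so_poly_ind: l => [||l IH1 IH2]; first by rewrite /so_poly size_poly1.
  by rewrite so_poly1 -polyC1 size_XaddC.
have sX : size ('X * so_poly R l.+1) = l.+3.
  by rewrite mulrC size_mulX ?IH2 // -size_poly_eq0 IH2.
by rewrite so_polySS size_polyDl sX // size_polyN IH1.
Qed.

Lemma so_poly_monic (R : comNzRingType) (l : nat) : so_poly R l \is monic.
Proof.
elim/so_poly_ind: l => [||l IH1 IH2]; first exact: monic1.
  by rewrite so_poly1 -polyC1 -[1%:P]opprK -polyCN monicXsubC.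
have sX : size ('X * so_poly R l.+1) = l.+3.
  by rewrite mulrC size_mulX ?size_so_poly // -size_poly_eq0 size_so_poly.
rewrite so_polySS monicE lead_coefDl ?sX ?size_polyN ?size_so_poly //.
by rewrite mulrC lead_coefMX; exact: IH2.
Qed.

Lemma map_so_poly (R S : comNzRingType) (f : {rmorphism R -> S}) (l : nat) :
  map_poly f (so_poly R l) = so_poly S l.
Proof.
elim/so_poly_ind: l => [||l IH1 IH2]; first by rewrite /so_poly rmorph1.
  by rewrite !so_poly1 rmorphD /= map_polyX rmorph1.
by rewrite !so_polySS rmorphB rmorphM /= map_polyX IH1 IH2.
Qed.

Lemma so_alternantE (F : fieldType) (N : nat) (lam : 'I_N -> nat) (y : 'I_N -> F) :
  (forall h, y h != 0) ->
  so_alternant lam y =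
  (\prod_(h < N) (y h - (y h)^-1)) *
  \det (\matrix_(h < N, t < N)
    (so_poly F (lam t + (N - t.+1))).[y h ^+ 2 + (y h ^+ 2)^-1]).
Proof.
move=> y0; have := det_diag (\row_h (y h - (y h)^-1)).
under eq_bigr do rewrite mxE; move=> <-.
rewrite -det_mulmx /so_alternant; congr (\det _); apply/matrixP => h t.
by rewrite mul_diag_mx !mxE so_polyE.
Qed.

Lemma so_alternant0E (F : fieldType) (N : nat) (y : 'I_N -> F) :
  (forall h, y h != 0) ->
  so_alternant (fun=> 0%N) y =
  (\prod_(h < N) (y h - (y h)^-1)) *
  alternant (fun=> 0%N) (fun h => y h ^+ 2 + (y h ^+ 2)^-1).
Proof.
move=> y0; rewrite so_alternantE //; congr (_ * _).
rewrite det_horner_small => [|t]; last first.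
  by rewrite size_so_poly add0n subnSK // leq_subr.
rewrite det_trig.
  rewrite big1 ?mulr1 // => i _; rewrite mxE add0n.
  by have /monicP := so_poly_monic F (N - i.+1); rewrite lead_coefE size_so_poly.
apply/is_trig_mxP => i j lt_ij; rewrite mxE nth_default // size_so_poly add0n.
by rewrite ltn_sub2l // (leq_ltn_trans _ (ltn_ord j)).
Qed.

Lemma peval_sub_inv (F : fieldType) (n : nat) (v : 'I_n -> F) (p : {mpoly int[n]}) :
  (forall i, v i != 0) ->
  exists P : laurent n, leval P v = peval p (fun i => v i + (v i)^-1).
Proof.
move=> v0; pose L f := exists P : laurent n, leval P v = f.
have m0 (e : 'X_{1..n}) : mmap1 v e != 0.
  by apply/prodf_neq0 => i _; rewrite expf_neq0.
have mD (e e' : 'X_{1..n}) : mmap1 v (e + e')%MM = mmap1 v e * mmap1 v e'.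
  by rewrite /mmap1 -big_split /=; apply: eq_bigr => i _; rewrite mnmDE exprD.
have LM f g : L f -> L g -> L (f * g).
  move=> [P <-] [Q <-]; exists (P.1 * Q.1, (P.2 + Q.2)%MM).
  by rewrite /leval /peval /= rmorphM /= mD invfM mulrACA.
have LD f g : L f -> L g -> L (f + g).
  move=> [P <-] [Q <-].
  exists (P.1 * 'X_[Q.2] + Q.1 * 'X_[P.2], (P.2 + Q.2)%MM).
  rewrite /leval /peval /= rmorphD !rmorphM /= !mmapX mD.
  by field; rewrite !m0.
have LC (c : int) : L c%:~R.
  by exists (c%:MP, 0%MM); rewrite /leval /peval /= mmapC mmap11 divr1.
have Lv i : L (v i + (v i)^-1).
  apply: LD.
    by exists ('X_i, 0%MM); rewrite /leval /peval /= mmapX mmap1U mmap11 divr1.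
  by exists (1, U_(i)%MM); rewrite /leval /peval /= rmorph1 mmap1U mul1r.
rewrite /peval /mmap; elim/big_rec: _ => [|e f _ Lf]; first exact: (LC 0).
apply: (LD) Lf; apply: (LM); first exact: LC.
rewrite /mmap1; elim/big_rec: _ => [|i f' _ Lf']; first exact: (LC 1).
apply: (LM) Lf'; elim: (e i) => [|k IH]; first exact: (LC 1).
by rewrite exprS; apply: (LM).
Qed.

Lemma var_neq0 (n : nat) (i : 'I_n) : var i != 0.
Proof. by rewrite /var tofrac_eq0 -msupp_eq0 msuppX. Qed.

Lemma so_alternant0_neq0 (n : nat) : so_alternant (fun=> 0%N) (@var n) != 0.
Proof.
have vE (i : 'I_n) : var i = tofrac 'X_[U_(i)%MM] by [].
have v0 := @var_neq0 n; rewrite so_alternant0E //; apply: mulf_neq0.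
  apply/prodf_neq0 => i _; apply/eqP => /eqP.
  rewrite subr_eq0 -(inj_eq (mulfI (v0 i))) divff // vE -tofracM -mpolyXD.
  rewrite -[1](tofrac1 {mpoly int[n]}) -mpolyX0 monom_eq => /eqP/mnmP/(_ i).
  by rewrite mnmDE mnm0E mnm1E eqxx.
apply: alternant0_neq0 => i j /eqP Eij; apply/eqP; apply/negPn/negP => ne_ij.
have : (var i ^+ 2 - var j ^+ 2) * (var i ^+ 2 * var j ^+ 2 - 1) = 0.
  have key (F : fieldType) (a b : F) : a != 0 -> b != 0 ->
      (a - b) * (a * b - 1) = a * b * ((a + a^-1) - (b + b^-1)).
    by move=> a0 b0; field; rewrite a0 b0.
  by rewrite key ?expf_neq0 // (eqP Eij) subrr mulr0.
move/eqP; rewrite mulf_eq0 !subr_eq0 !vE -!tofracXn !mpolyXn -tofracM -mpolyXD.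
rewrite -[1](tofrac1 {mpoly int[n]}) -mpolyX0 !monom_eq.
case/orP => /eqP/mnmP/(_ i).
  by rewrite !mulmnE !mnm1E eqxx eq_sym (negPf ne_ij).
by rewrite mnmDE !mulmnE mnm0E !mnm1E eqxx.
Qed.

(* In this quotient the indeterminates are the square roots of the variables  *)
(* of the character, which is why the Laurent polynomial P is evaluated at    *)
(* their squares.                                                             *)
Lemma so_exists (N : nat) (lam : 'I_N -> nat) :
  exists P : laurent N,
    leval P (fun i => @var N i ^+ 2) ==
    so_alternant lam (@var N) / so_alternant (fun=> 0%N) (@var N).
Proof.
have y0 := @var_neq0 N.
pose z i := @var N i ^+ 2 + (@var N i ^+ 2)^-1.
have [c Dc] := det_horner (fun i => 'X_i : {mpoly int[N]})
                 (fun t => so_poly {mpoly int[N]} (lam t + (N - t.+1))).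
have {}Dc : \det (\matrix_(h < N, t < N)
      (so_poly (ratfun N) (lam t + (N - t.+1))).[z h]) =
    alternant (fun=> 0%N) z * peval c z.
  have zX h : mmap (intr : int -> ratfun N) z ('X_h : {mpoly int[N]}) = z h.
    by rewrite mmapX mmap1U.
  have := congr1 (mmap (intr : int -> ratfun N) z) Dc.
  rewrite rmorphM /= /alternant -!det_map_mx /= => E.
  transitivity (\det (map_mx (mmap (intr : int -> ratfun N) z)
    (\matrix_(h < N, t < N)
       (so_poly {mpoly int[N]} (lam t + (N - t.+1))).['X_h]))).
    congr (\det _); apply/matrixP => h t; rewrite !mxE -zX.
    rewrite -(map_so_poly (mmap (intr : int -> ratfun N) z)).
    by rewrite horner_map.
  rewrite E; congr (\det _ * _); apply/matrixP => h t.
  by rewrite !mxE rmorphXn /= zX.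
have [P HP] : exists P : laurent N, leval P (fun i => @var N i ^+ 2) = peval c z.
  by apply: peval_sub_inv => i; rewrite expf_neq0.
have := so_alternant0_neq0 N; rewrite so_alternant0E // so_alternantE // => nz.
rewrite -/z Dc mulrA.
by exists P; rewrite HP mulrAC divff ?mul1r.
Qed.

Definition so (N : nat) (lam : 'I_N -> nat) : laurent N := xchoose (so_exists lam).

Lemma soE (N : nat) (lam : 'I_N -> nat) :
  leval (so lam) (fun i => @var N i ^+ 2) =
  so_alternant lam (@var N) / so_alternant (fun=> 0%N) (@var N).
Proof. exact/eqP/(xchooseP (so_exists lam)). Qed.

(* The partition (M^k), padded with zeros to N parts.                         *)
Definition rect (N M k : nat) : 'I_N -> nat := fun i => if (i < k)%N then M else 0%N.

Arguments rect N M k _ : clear implicits.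

Lemma ltn_half_ord (n : nat) (i : 'I_(2 * n)) : (i./2 < n)%N.
Proof. by rewrite ltn_half_double -mul2n. Qed.

(* The point (x_1, x_1^-1, ..., x_n, x_n^-1).                                 *)
Definition pm_vars (n : nat) : 'I_(2 * n) -> ratfun n :=
  fun i => let x := var (Ordinal (ltn_half_ord i)) in if odd i then x^-1 else x.
Arguments pm_vars n _ : clear implicits.

(* Main.v *)
(* Dividing the rows of the points x and x^-1 by x^(m+n) and x^-(m+n), the    *)
(* numerators of the two Schur functions differ in the n-th column only, and  *)
(* their sum is one determinant whose columns are x^(m+n), ..., x^(m+2),      *)
(* x^(m+1) + x^-m, x^(-m-1), ..., x^(-m-n). The exponents e and 1 - e occur   *)
(* in pairs, so column operations turn the first n columns into x^e +         *)
(* x^(1-e), for e = m+1, ..., m+n. For a function f take f(x) - x f(x^-1) and *)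
(* f(x) + x f(x^-1) as the new rows: the first kind vanishes on these n       *)
(* columns, and the determinant factors as det (x^(l+1) + x^-l) det (x^-l -   *)
(* x^(l+1)), with l = m, ..., m+n-1 in the first factor and l = m+1, ..., m+n *)
(* in the second. Up to row and column factors these are the numerators of    *)
(* so_(m^n)(-x) and so_((m+1)^n)(x). The same procedure applied to the        *)
(* denominator of the Schur functions gives the two denominators; the         *)
(* constants agree up to the sign (-1)^(mn).                                  *)
Require Import Defs.
From mathcomp Require Import all_boot all_order all_algebra all_fingroup.
From mathcomp Require Import ring zify.

Set Implicit Arguments.
Unset Strict Implicit.
Unset Printing Implicit Defensive.

Import GRing.Theory.
Local Open Scope ring_scope.

(** Under the involution f(x) -> x f(x^-1) the 2n by 2n alternant splits into a symmetric and an
    antisymmetric n by n block, which are numerators of characters at -x and at x.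
    [alternant_rect_pm] does the column operations and [det_pm_block] the splitting, by one formula
    for the numerators and the denominator, so the common constants cancel in [sum_of_quotients].
    Since [so] is specified only at squares of indeterminates, [laurent_family_eq] is needed to
    reach x and -x; [so_mul_det] and [schur_mul_alternant] are the resulting determinant formulas,
    cleared of denominators. *)

(** * Transfer of Laurent polynomial identities *)

Lemma peval_var_sqr_inj (n : nat) (p : {mpoly int[n]}) :
  peval p (fun i => @var n i ^+ 2) = 0 -> p = 0.
Proof.
have mE (m : 'X_{1..n}) : mmap1 (fun i => @var n i ^+ 2) m = tofrac 'X_[m *+ 2].
  rewrite mpolyXE_id rmorph_prod; apply: eq_bigr => i _.
  by rewrite rmorphXn /= mulmnE exprAC -exprM mulnC.
have -> : peval p (fun i => @var n i ^+ 2) =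
    tofrac (\sum_(m <- msupp p) p@_m *: 'X_[m *+ 2]).
  rewrite rmorph_sum /peval /mmap; apply: eq_bigr => m _.
  by rewrite mE -mul_mpolyC rmorphM /= -[p@_m in RHS]intz !rmorph_int.
move/eqP; rewrite tofrac_eq0 => /eqP E; apply/mpolyP => m; rewrite mcoeff0.
(* Doubling exponents is injective, so the coefficient of [p] at m is read off at 2m. *)
have := congr1 (fun q : {mpoly int[n]} => q@_(m *+ 2)) E.
rewrite mcoeff0 raddf_sum /=.
have inj2 (a b : 'X_{1..n}) : ((a *+ 2)%MM == (b *+ 2)%MM) = (a == b).
  apply/eqP/eqP => [/mnmP ab|-> //]; apply/mnmP => i.
  by have := ab i; rewrite !mulmnE; lia.
have [mp|mp _] := boolP (m \in msupp p); last exact: memN_msupp_eq0.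
rewrite (bigD1_seq m) ?msupp_uniq //= big1 ?addr0 => [|i ne].
  by rewrite mcoeffZ mcoeffX eqxx mulr1.
by rewrite mcoeffZ mcoeffX inj2 (negPf ne) mulr0.
Qed.

(* Families given by a single Laurent polynomial over every field at once: an *)
(* identity between two of them can be moved from the squares of the          *)
(* indeterminates to any point.                                               *)
Definition laurent_family (n : nat) (f : forall F : fieldType, ('I_n -> F) -> F) :=
  exists P : laurent n, forall (F : fieldType) (v : 'I_n -> F),
    (forall i, v i != 0) -> f F v = leval P v.

Lemma mmap1_neq0 (F : fieldType) (n : nat) (v : 'I_n -> F) (e : 'X_{1..n}) :
  (forall i, v i != 0) -> mmap1 v e != 0.
Proof. by move=> v0; apply/prodf_neq0 => i _; rewrite expf_neq0. Qed.

Lemma mmap1_addm (F : fieldType) (n : nat) (v : 'I_n -> F) (e e' : 'X_{1..n}) :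
  mmap1 v (e + e')%MM = mmap1 v e * mmap1 v e'.
Proof.
by rewrite /mmap1 -big_split /=; apply: eq_bigr => i _; rewrite mnmDE exprD.
Qed.

Lemma laurent_familyC (n : nat) (c : int) :
  @laurent_family n (fun F v => c%:~R).
Proof.
by exists (c%:MP, 0%MM) => F v _; rewrite /leval /peval /= mmapC mmap11 divr1.
Qed.

Lemma laurent_familyX (n : nat) (i : 'I_n) :
  @laurent_family n (fun F v => v i).
Proof.
by exists ('X_i, 0%MM) => F v _; rewrite /leval /peval /= mmapX mmap1U mmap11 divr1.
Qed.

Lemma laurent_familyV (n : nat) (i : 'I_n) :
  @laurent_family n (fun F v => (v i)^-1).
Proof.
by exists (1, U_(i)%MM) => F v _; rewrite /leval /peval /= rmorph1 mmap1U mul1r.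
Qed.

Lemma laurent_familyM (n : nat) f g : @laurent_family n f ->
  @laurent_family n g -> laurent_family (fun F v => f F v * g F v).
Proof.
move=> [P fP] [Q gQ]; exists (P.1 * Q.1, (P.2 + Q.2)%MM) => F v v0.
by rewrite fP ?gQ // /leval /peval /= rmorphM /= mmap1_addm invfM mulrACA.
Qed.

Lemma laurent_familyD (n : nat) f g : @laurent_family n f ->
  @laurent_family n g -> laurent_family (fun F v => f F v + g F v).
Proof.
move=> [P fP] [Q gQ].
exists (P.1 * 'X_[Q.2] + Q.1 * 'X_[P.2], (P.2 + Q.2)%MM) => F v v0.
rewrite fP ?gQ // /leval /peval /= rmorphD !rmorphM /= !mmapX mmap1_addm.
by field; rewrite !mmap1_neq0.
Qed.

Lemma laurent_family_sum (n : nat) (I : Type) (r : seq I) f :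
  (forall i, @laurent_family n (f i)) ->
  laurent_family (fun F v => \sum_(i <- r) f i F v).
Proof.
move=> fL; elim: r => [|i r [P IH]].
  have [P PE] := laurent_familyC n 0.
  by exists P => F v v0; rewrite big_nil -PE.
have [Q QE] := laurent_familyD (fL i) (ex_intro _ P IH).
by exists Q => F v v0; rewrite big_cons -QE.
Qed.

Lemma laurent_family_prod (n : nat) (I : Type) (r : seq I) f :
  (forall i, @laurent_family n (f i)) ->
  laurent_family (fun F v => \prod_(i <- r) f i F v).
Proof.
move=> fL; elim: r => [|i r [P IH]].
  have [P PE] := laurent_familyC n 1.
  by exists P => F v v0; rewrite big_nil -PE.
have [Q QE] := laurent_familyM (fL i) (ex_intro _ P IH).
by exists Q => F v v0; rewrite big_cons -QE.
Qed.

Lemma laurent_family_det (n N : nat) f :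
  (forall i j, @laurent_family n (f i j)) ->
  laurent_family (fun F v => \det (\matrix_(i < N, j < N) f i j F v)).
Proof.
move=> fL; pose g (s : 'S_N) (F : fieldType) (v : 'I_n -> F) :=
  ((-1) ^+ s)%:~R * \prod_i f i (s i) F v.
have [s|P PE] := laurent_family_sum (index_enum _) (f := g).
  by apply: laurent_familyM; [apply: laurent_familyC|apply: laurent_family_prod].
exists P => F v v0; rewrite -PE //; apply: eq_bigr => s _.
rewrite /g rmorphXn /= rmorphN1; congr (_ * _).
by apply: eq_bigr => i _; rewrite mxE.
Qed.

Lemma laurent_family_so_poly (n l : nat) (h : 'I_n) :
  laurent_family (fun F v => (so_poly F l).[v h + (v h)^-1]).
Proof.
have zL : laurent_family (fun (F : fieldType) v => v h + (v h)^-1).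
  by apply: laurent_familyD; [apply: laurent_familyX|apply: laurent_familyV].
elim/so_poly_ind: l => [||l IH1 IH2].
- have [P PE] := laurent_familyC n 1.
  by exists P => F v v0; rewrite -PE // /so_poly hornerC.
- have [P PE] := laurent_familyD zL (laurent_familyC n 1).
  by exists P => F v v0; rewrite -PE // so_poly1 !hornerE.
have [P PE] := laurent_familyD (laurent_familyM zL IH2)
  (laurent_familyM (laurent_familyC n (-1)) IH1).
by exists P => F v v0; rewrite -PE // so_polySS !hornerE rmorphN1 mulN1r.
Qed.

(** Cross-multiplying at the squares gives, by [peval_var_sqr_inj], an identity in Z[x], which
    evaluates over any field. *)
Lemma laurent_family_eq (n : nat) f g : @laurent_family n f ->
  laurent_family g ->
  f _ (fun i => @var n i ^+ 2) = g _ (fun i => @var n i ^+ 2) ->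
  forall (F : fieldType) (v : 'I_n -> F), (forall i, v i != 0) -> f F v = g F v.
Proof.
move=> [P fP] [Q gQ].
have vv0 i : @var n i ^+ 2 != 0 by rewrite expf_neq0 // var_neq0.
rewrite fP // gQ // => E F v v0; rewrite fP // gQ //.
have /peval_var_sqr_inj : peval (P.1 * 'X_[Q.2] - Q.1 * 'X_[P.2])
    (fun i => @var n i ^+ 2) = 0.
  rewrite /peval rmorphB !rmorphM /= !mmapX; apply/eqP; rewrite subr_eq0.
  by rewrite /leval in E; rewrite -eqr_div ?E //; exact: mmap1_neq0.
move/eqP; rewrite subr_eq0 => /eqP /(congr1 (mmap (intr : int -> F) v)).
rewrite !rmorphM /= !mmapX => /eqP.
by rewrite -eqr_div ?mmap1_neq0 // => /eqP.
Qed.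

(** * Characters and Schur functions as determinants *)

(** The numerator of the character without its row factors x^(1/2) - x^(-1/2); it needs no square
    roots, so it makes sense at -x. *)
Definition so_det (F : fieldType) (N : nat) (lam : 'I_N -> nat) (v : 'I_N -> F) :=
  \det (\matrix_(h < N, t < N)
    (so_poly F (lam t + (N - t.+1))).[v h + (v h)^-1]).

Lemma mulf_divK (F : fieldType) (p a b : F) :
  p != 0 -> b != 0 -> p * a / (p * b) * b = a.
Proof. by move=> p0 b0; field; rewrite p0 b0. Qed.

Lemma so_mul_det (F : fieldType) (N : nat) (lam : 'I_N -> nat) (v : 'I_N -> F) :
  (forall i, v i != 0) ->
  leval (so lam) v * so_det (fun=> 0%N) v = so_det lam v.
Proof.
move: F v; have dL l : laurent_family (fun (F : fieldType) (v : 'I_N -> F) => so_det l v).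
  by apply: laurent_family_det => i j; apply: laurent_family_so_poly.
have sL : laurent_family (fun (F : fieldType) (v : 'I_N -> F) => leval (so lam) v).
  by exists (so lam).
apply: (laurent_family_eq (laurent_familyM sL (dL (fun=> 0%N))) (dL lam)).
have y0 := @var_neq0 N; rewrite soE.
have := so_alternant0_neq0 N; rewrite !so_alternantE // mulf_eq0 negb_or.
rewrite -!/(so_det _ (fun h => var h ^+ 2)) => /andP[p0 d0].
by move: p0 d0; apply: mulf_divK.
Qed.

Lemma tofrac_eq_div (R : idomainType) (p a b : R) (A B : {fraction R}) :
  A = tofrac a -> B = tofrac b -> B != 0 -> tofrac p = A / B -> p * b = a.
Proof.
move=> Aa Bb B0 E; apply/eqP; rewrite -tofrac_eq tofracM E -Aa -Bb.
by rewrite divfK.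
Qed.

Lemma schur_mul_alternant (F : fieldType) (N : nat) (lam : 'I_N -> nat) (v : 'I_N -> F) :
  peval (schur lam) v * alternant (fun=> 0%N) v = alternant lam v.
Proof.
have tf l : alternant l (@var N) = tofrac (alternant l (fun i => 'X_i : {mpoly int[N]})).
  rewrite /alternant -det_map_mx; congr (\det _).
  by apply/matrixP => h t; rewrite !mxE rmorphXn.
have ev l : mmap (intr : int -> F) v (alternant l (fun i => 'X_i)) = alternant l v.
  rewrite /alternant -det_map_mx; congr (\det _).
  by apply/matrixP => h t; rewrite !mxE rmorphXn /= mmapX mmap1U.
rewrite -!ev /peval -rmorphM /=; congr (mmap _ _ _).
have nz := alternant0_neq0 (@var_inj N).
exact: tofrac_eq_div (tf _) (tf _) nz (schurE lam).
Qed.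

(** This is [so_polyE] multiplied by y, with v = y^2. *)
Lemma so_poly_at (F : fieldType) (v : F) (l : nat) : v != 0 ->
  (v - 1) * (so_poly F l).[v + v^-1] = v ^+ l.+1 - v ^- l.
Proof.
move=> v0; elim/so_poly_ind: l => [||l IH1 IH2].
- by rewrite /so_poly hornerC expr1 expr0 invr1 mulr1.
- by rewrite so_poly1 !hornerE; field.
rewrite so_polySS !hornerE mulrBr mulrCA IH2 IH1 !exprS.
have : v ^+ l != 0 by rewrite expf_neq0.
by move: (v ^+ l) => w w0; field; rewrite w0 v0.
Qed.

(** The exponents l+1 and -l have opposite parities, so passing to -x turns the difference into a
    sum, up to sign. *)
Lemma so_poly_atN (F : fieldType) (x : F) (l : nat) : x != 0 ->
  (-1) ^+ l * (x + 1) * (so_poly F l).[- x + (- x)^-1] = x ^+ l.+1 + x ^- l.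
Proof.
move=> x0; have := so_poly_at (v := - x) l; rewrite oppr_eq0 => /(_ x0) E.
have -> : x + 1 = - (- x - 1) by ring.
rewrite mulrN mulNr -mulrA E (exprNn x) (exprNn x l) exprS invfM.
have : (-1) ^+ l != 0 :> F by rewrite signr_eq0.
have : ((-1) ^+ l) ^+ 2 = 1 :> F by rewrite sqrr_sign.
move: ((-1) ^+ l) => e e1 e0.
have -> : e^-1 = e by apply: (mulfI e0); rewrite divff // -expr2.
transitivity (e ^+ 2 * (x ^+ l.+1 + (x ^+ l)^-1)); first by ring.
by rewrite e1 mul1r.
Qed.

(** * Determinant identities *)

Lemma det_scale (R : comNzRingType) (N : nat) (a b : 'I_N -> R) (M : 'M[R]_N) :
  \det (\matrix_(i, j) (a i * b j * M i j)) = (\prod_i a i) * (\prod_j b j) * \det M.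
Proof.
have E (c : 'I_N -> R) : \prod_i c i = \det (diag_mx (\row_i c i)).
  by rewrite det_diag; apply: eq_bigr => i _; rewrite mxE.
rewrite !E mulrAC -!det_mulmx; congr (\det _); apply/matrixP => i j.
by rewrite mul_mx_diag mul_diag_mx !mxE mulrAC.
Qed.

(** The sign is fixed before the matrix, so numerators and denominator share it. *)
Lemma det_mxsub_inj (N N' : nat) (f g : 'I_N -> 'I_N') : N = N' ->
  injective f -> injective g -> exists b : bool,
  forall (R : comNzRingType) (A : 'M[R]_N'), \det (mxsub f g A) = (-1) ^+ b * \det A.
Proof.
move=> e; case: N' / e f g => f g fI gI.
exists (perm fI (+) perm gI) => R A.
have -> : mxsub f g A = row_perm (perm fI) (col_perm (perm gI) A).
  by apply/matrixP => i j; rewrite !mxE !permE.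
rewrite row_permE col_permE !det_mulmx !det_perm odd_permV signr_addb.
by rewrite [\det A * _]mulrC mulrA.
Qed.

Lemma det_hadamard (R : comNzRingType) (n : nat) :
  \det (block_mx 1%:M 1%:M 1%:M (- 1%:M) : 'M[R]_(n + n)) = (- 2%:R) ^+ n.
Proof.
have -> : (block_mx 1%:M 1%:M 1%:M (- 1%:M) : 'M[R]_(n + n)) =
    block_mx 1%:M 0 1%:M 1%:M *m block_mx 1%:M 1%:M 0 (- 2%:R)%:M.
  rewrite mulmx_block !mul1mx !mul0mx !addr0; congr block_mx.
  apply/matrixP => i j; rewrite !mxE -mulrnDl.
  rewrite -mulNrn; congr (_ *+ _); ring.
by rewrite det_mulmx det_lblock det_ublock !det1 !mul1r det_scalar.
Qed.

(** Weight the rows by a and b, then take sums and differences of the two halves (the matrix of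
    [det_hadamard]): the hypothesis kills the lower left block. *)
Lemma det_block_fold (R : comNzRingType) (n : nat) (A B C E : 'M[R]_n) (a b : 'I_n -> R) :
  (forall h t, a h * A h t = b h * C h t) ->
  (- 2%:R) ^+ n * ((\prod_h a h) * (\prod_h b h)) * \det (block_mx A B C E) =
  \det (\matrix_(h, t) (a h * A h t + b h * C h t)) *
  \det (\matrix_(h, t) (a h * B h t - b h * E h t)).
Proof.
move=> AC; have D (c : 'I_n -> R) : \prod_h c h = \det (diag_mx (\row_h c h)).
  by rewrite det_diag; apply: eq_bigr => h _; rewrite mxE.
rewrite -det_hadamard !D -(det_ublock (diag_mx _) 0) -det_mulmx -det_mulmx.
rewrite !mulmx_block !mul1mx !mulmx0 !addr0 !add0r !mulNmx !mul1mx.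
rewrite -(det_ublock _ (diag_mx (\row_h a h) *m B + diag_mx (\row_h b h) *m E)).
congr (\det (block_mx _ _ _ _)); apply/matrixP => h t.
- by rewrite !mul_diag_mx !mxE.
- by rewrite !mul_diag_mx !mxE AC subrr.
- by rewrite !mul_diag_mx !mxE.
Qed.

Lemma det_col_fold (R : comNzRingType) (n : nat) (A B C E S : 'M[R]_n) :
  \det (block_mx A B C E) = \det (block_mx (A + B *m S) B (C + E *m S) E).
Proof.
have -> : block_mx (A + B *m S) B (C + E *m S) E =
    block_mx A B C E *m block_mx 1%:M 0 S 1%:M.
  by rewrite mulmx_block !mulmx1 !mulmx0 !add0r.
by rewrite det_mulmx det_lblock !det1 !mulr1.
Qed.

(** * Factorization of the symmetrized determinant *)

(* The exponents in the first n columns are symmetric about k + 1/2, where    *)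
(* k = m+n for the sum of the numerators and k = n-1 for the denominator.     *)
Definition pm_block (F : fieldType) (n k : nat) (q r : 'I_n -> nat) (x : 'I_n -> F) :=
  block_mx (\matrix_(h < n, t < n) (x h ^+ (2 * k + 1 - q t) + x h ^+ q t))
           (\matrix_(h < n, t < n) x h ^+ r t)
           (\matrix_(h < n, t < n) ((x h)^-1 ^+ (2 * k + 1 - q t) + (x h)^-1 ^+ q t))
           (\matrix_(h < n, t < n) (x h)^-1 ^+ r t).

(** The weights x^-k and x^(k+1) on the rows of x and x^-1 recentre the exponents at 1/2: q and
    2k+1-q become -l and l+1, in swapped order on the second row. *)
Lemma pm_shift (F : fieldType) (x : F) (k q : nat) : x != 0 -> (q <= k)%N ->
  x ^- k * x ^+ q = x ^- (k - q) /\ x ^+ k.+1 * (x^-1) ^+ q = x ^+ (k - q).+1 /\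
  x ^- k * x ^+ (2 * k + 1 - q) = x ^+ (k - q).+1 /\
  x ^+ k.+1 * (x^-1) ^+ (2 * k + 1 - q) = x ^- (k - q).
Proof.
move=> x0 /subnKC <-; set l := (k - q)%N.
have -> : (2 * (q + l) + 1 - q = (q + l + l).+1)%N by lia.
have -> : (q + l - q = l)%N by lia.
rewrite !exprVn !exprS !exprD.
have : x ^+ q != 0 by rewrite expf_neq0.
have : x ^+ l != 0 by rewrite expf_neq0.
move: (x ^+ l) (x ^+ q) => w y w0 y0.
by split; [|split; [|split]]; field; rewrite ?w0 ?y0 ?x0.
Qed.

(* K does not depend on k, m and m', so it cancels between the numerator and  *)
(* the denominator of the Schur functions.                                    *)
Lemma det_pm_block (F : fieldType) (n : nat) (x : 'I_n -> F) :
  (forall h, x h != 0) ->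
  exists K : F, forall (k m m' : nat) (q r : 'I_n -> nat),
    (forall t, k = q t + (m + (n - t.+1)))%N ->
    (forall t, k = r t + (m' + (n - t.+1)))%N ->
    (- 2%:R) ^+ n * (\prod_h x h) * \det (pm_block k q r x) =
    (-1) ^+ (m * n) * K *
      (so_det (fun=> m) (fun h => - x h) * so_det (fun=> m') x).
Proof.
move=> x0.
(* The row factors come from [so_poly_atN] and [so_poly_at]; the signs are the part of
   (-1)^(m+n-1-t) free of m, the rest being the sign (-1)^(mn) of the theorem. *)
exists ((\prod_h (2%:R * (x h + 1))) * (\prod_(t < n) (-1) ^+ (n - t.+1)) *
        (\prod_h (- (x h - 1)))) => k m m' q r kq kr.
have lq t : (k - q t = m + (n - t.+1))%N by have := kq t; lia.
have lr t : (k - r t = m' + (n - t.+1))%N by have := kr t; lia.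
have qk t : (q t <= k)%N by have := kq t; lia.
have rk t : (r t <= k)%N by have := kr t; lia.
have -> : \prod_h x h = (\prod_h x h ^- k) * (\prod_h x h ^+ k.+1).
  rewrite -big_split; apply: eq_bigr => h _ /=.
  by rewrite exprSr mulKf ?expf_neq0.
rewrite det_block_fold => [|h t]; last first.
  have [e1 [e2 [e3 e4]]] := pm_shift (x0 h) (qk t).
  by rewrite !mxE !mulrDr e1 e2 e3 e4 addrC.
have -> : \matrix_(h, t) (x h ^- k *
      (\matrix_(h0, t0) (x h0 ^+ (2 * k + 1 - q t0) + x h0 ^+ q t0)) h t +
    x h ^+ k.+1 *
      (\matrix_(h0, t0) ((x h0)^-1 ^+ (2 * k + 1 - q t0) + (x h0)^-1 ^+ q t0)) h t) =
    \matrix_(h, t) (2%:R * (x h + 1) * (-1) ^+ (m + (n - t.+1)) *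
      (\matrix_(h, t) (so_poly F (m + (n - t.+1))).[- x h + (- x h)^-1]) h t).
  apply/matrixP => h t; rewrite !mxE.
  have [e1 [e2 [e3 e4]]] := pm_shift (x0 h) (qk t).
  transitivity (2%:R * (x h ^+ (k - q t).+1 + x h ^- (k - q t))).
    by rewrite [X in X + _]mulrDr [X in _ + X]mulrDr e1 e2 e3 e4; ring.
  by rewrite lq -(so_poly_atN _ (x0 h)); ring.
have -> : \matrix_(h, t) (x h ^- k * (\matrix_(h0, t0) x h0 ^+ r t0) h t -
    x h ^+ k.+1 * (\matrix_(h0, t0) (x h0)^-1 ^+ r t0) h t) =
    \matrix_(h, t) (- (x h - 1) * 1 *
      (\matrix_(h, t) (so_poly F (m' + (n - t.+1))).[x h + (x h)^-1]) h t).
  apply/matrixP => h t; rewrite !mxE.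
  have [e1 [e2 _]] := pm_shift (x0 h) (rk t).
  by rewrite e1 e2 lr mulr1 mulNr (so_poly_at _ (x0 h)) opprB.
rewrite !det_scale -!/(so_det _ _) big1_eq mulr1.
have -> : \prod_(t < n) (-1) ^+ (m + (n - t.+1)) =
    (-1) ^+ (m * n) * \prod_(t < n) (-1) ^+ (n - t.+1) :> F.
  under eq_bigr do rewrite exprD.
  by rewrite big_split prodr_const card_ord -exprM.
by ring.
Qed.

(** * Alternants in block form *)

Lemma row_order_subproof (n : nat) (i : 'I_(n + n)) :
  ((if i < n then 2 * i else 2 * (i - n) + 1) < 2 * n)%N.
Proof. by case: i => i /= ?; case: ifP; lia. Qed.

(** The points x_h sit at even positions of [pm_vars]; they are moved before their inverses. *)
Definition row_order (n : nat) (i : 'I_(n + n)) : 'I_(2 * n) :=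
  Ordinal (row_order_subproof i).

Lemma col_order_subproof (n : nat) (i : 'I_(n + n)) :
  ((if i < n then i : nat else 3 * n - i.+1) < 2 * n)%N.
Proof. by case: i => i /= ?; case: ifP; lia. Qed.

(* Reversing the last n columns makes their exponents 0, ..., n-1. *)
Definition col_order (n : nat) (i : 'I_(n + n)) : 'I_(2 * n) :=
  Ordinal (col_order_subproof i).

Lemma row_order_inj (n : nat) : injective (@row_order n).
Proof.
move=> [i ?] [j ?] /(congr1 val) /= E; apply/val_inj => /=.
by move: E; do 2 case: ifP; lia.
Qed.

Lemma col_order_inj (n : nat) : injective (@col_order n).
Proof.
move=> [i ?] [j ?] /(congr1 val) /= E; apply/val_inj => /=.
by move: E; do 2 case: ifP; lia.
Qed.

Lemma col_orderl (n : nat) (t : 'I_n) : col_order (lshift n t) = t :> nat.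
Proof. by rewrite /= ltn_ord. Qed.

Lemma col_orderr (n : nat) (t : 'I_n) : col_order (rshift n t) = (2 * n - t.+1)%N :> nat.
Proof. by rewrite /=; case: ifP; lia. Qed.

Lemma det_order (n : nat) : exists b : bool, forall (R : comNzRingType)
    (A : 'M[R]_(2 * n)),
  \det A = (-1) ^+ b * \det (block_mx
    (\matrix_(h, t) A (row_order (lshift n h)) (col_order (lshift n t)))
    (\matrix_(h, t) A (row_order (lshift n h)) (col_order (rshift n t)))
    (\matrix_(h, t) A (row_order (rshift n h)) (col_order (lshift n t)))
    (\matrix_(h, t) A (row_order (rshift n h)) (col_order (rshift n t)))).
Proof.
have [|b bE] := det_mxsub_inj _ (@row_order_inj n) (@col_order_inj n); first lia.
exists b => R A; rewrite -[LHS](signrMK b) -bE.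
congr (_ * \det _); rewrite -[LHS]submxK.
by congr block_mx; apply/matrixP => h t; rewrite !mxE.
Qed.

Lemma alternantD_col (R : comNzRingType) (N : nat) (lam mu : 'I_N -> nat)
    (i : 'I_N) (v : 'I_N -> R) : (forall t, t != i -> lam t = mu t) ->
  alternant lam v + alternant mu v =
  \det (\matrix_(h < N, t < N) (v h ^+ (lam t + (N - t.+1)) +
    if t == i then v h ^+ (mu t + (N - t.+1)) else 0)).
Proof.
move=> lm; rewrite /alternant -!(det_tr (\matrix_(_, _) _)).
apply/esym; rewrite -[X in X + _]mul1r -[X in _ + X]mul1r.
apply: (determinant_multilinear (i0 := i)).
- by apply/rowP => h; rewrite !mxE eqxx !mul1r.
- apply/matrixP => t h; rewrite !mxE eq_sym (negPf (neq_lift _ _)).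
  by rewrite addr0.
- apply/matrixP => t h; rewrite !mxE eq_sym (negPf (neq_lift _ _)).
  by rewrite addr0 lm // eq_sym neq_lift.
Qed.

Lemma alternant_rect_pm (F : fieldType) (n : nat) (x : 'I_n -> F) (v : 'I_(2 * n) -> F) :
  (forall h, v (row_order (lshift n h)) = x h) ->
  (forall h, v (row_order (rshift n h)) = (x h)^-1) ->
  exists b : bool,
    alternant (fun=> 0%N) v = (-1) ^+ b * \det (pm_block n.-1 val val x) /\
    forall m, (0 < n)%N ->
      alternant (rect (2 * n) (2 * m + 1) n) v
        + alternant (rect (2 * n) (2 * m + 1) (n - 1)) v =
      (-1) ^+ b * \det (pm_block (m + n) (fun t => t.+1) val x).
Proof.
move=> vl vr; have [b bE] := det_order n; exists b; split=> [|m n0].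
  (* The exponent 2n-1-t is paired with t, which is column t of the second half. *)
  rewrite /alternant bE (det_col_fold _ _ _ _ 1%:M) !mulmx1.
  congr (_ * \det (block_mx _ _ _ _)); apply/matrixP => h t;
    rewrite !mxE; have tn := ltn_ord t.
  - rewrite vl col_orderl col_orderr; congr (_ ^+ _ + _ ^+ _); rewrite /=; lia.
  - rewrite vl col_orderr; congr (_ ^+ _); rewrite /=; lia.
  - rewrite vr col_orderl col_orderr; congr (_ ^+ _ + _ ^+ _); rewrite /=; lia.
  - rewrite vr col_orderr; congr (_ ^+ _); rewrite /=; lia.
have i_lt : (n.-1 < 2 * n)%N by lia.
rewrite (@alternantD_col _ _ _ _ (Ordinal i_lt)) => [|t]; last first.
  rewrite -(inj_eq val_inj) /rect /= => ?.
  by case: ifP; case: ifP; lia.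
(* The partner of the exponent 2m+2n-t is t+1, found in column t+1 of the second half. For t = n-1
   no such column exists, and the second alternant supplies the missing exponent n. *)
pose S : 'M[F]_n := \matrix_(s, t) (s == t.+1 :> nat)%:R.
have SE (C : 'M[F]_n) (c : F) h : (forall s, C h s = c ^+ s) ->
    forall t, (C *m S) h t = if (t.+1 < n)%N then c ^+ t.+1 else 0.
  move=> Cc t; rewrite mxE; case: ifPn => tn.
    rewrite (bigD1 (Ordinal tn)) //= big1 => [|s].
      by rewrite mxE eqxx Cc mulr1 addr0.
    by rewrite -(inj_eq val_inj) /= => /negPf ne; rewrite mxE ne mulr0.
  rewrite big1 // => s _; rewrite mxE; case: eqP => [E|_]; last by rewrite mulr0.
  by move: tn; rewrite -E ltn_ord.
have col1 (y : F) (t : 'I_n) :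
    y ^+ (rect (2 * n) (2 * m + 1) n (col_order (lshift n t))
          + (2 * n - (col_order (lshift n t)).+1)) +
      (if col_order (lshift n t) == Ordinal i_lt
       then y ^+ (rect (2 * n) (2 * m + 1) (n - 1) (col_order (lshift n t))
          + (2 * n - (col_order (lshift n t)).+1)) else 0) +
      (if (t.+1 < n)%N then y ^+ t.+1 else 0) =
    y ^+ (2 * (m + n) + 1 - t.+1) + y ^+ t.+1.
  rewrite -(inj_eq val_inj) /rect !col_orderl ltn_ord /= ltn_ord.
  rewrite -addrA; congr (_ ^+ _ + _); first by have := ltn_ord t; lia.
  have := ltn_ord t; case: eqP => [E|ne] tn.
    have -> : (t < n - 1)%N = false by lia.
    have -> : (t.+1 < n)%N = false by lia.
    by rewrite addr0; congr (_ ^+ _); lia.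
  have -> : (t.+1 < n)%N by lia.
  by rewrite add0r.
have col2 (y : F) (t : 'I_n) :
    y ^+ (rect (2 * n) (2 * m + 1) n (col_order (rshift n t))
          + (2 * n - (col_order (rshift n t)).+1)) +
      (if col_order (rshift n t) == Ordinal i_lt
       then y ^+ (rect (2 * n) (2 * m + 1) (n - 1) (col_order (rshift n t))
          + (2 * n - (col_order (rshift n t)).+1)) else 0) = y ^+ t.
  have tn := ltn_ord t; rewrite /rect !col_orderr.
  have -> : (col_order (rshift n t) == Ordinal i_lt) = false.
    by apply/eqP => /(congr1 (@nat_of_ord _)); rewrite col_orderr /=; lia.
  have -> : (2 * n - t.+1 < n)%N = false by lia.
  by rewrite addr0; congr (_ ^+ _); lia.
rewrite bE (det_col_fold _ _ _ _ S); congr (_ * \det (block_mx _ _ _ _)).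
- apply/matrixP => h t; rewrite mxE (SE _ (x h)) => [|s].
    by rewrite !mxE vl col1.
  by rewrite !mxE vl col2.
- by apply/matrixP => h t; rewrite !mxE vl col2.
- apply/matrixP => h t; rewrite mxE (SE _ (x h)^-1) => [|s].
    by rewrite !mxE vr col1.
  by rewrite !mxE vr col2.
- by apply/matrixP => h t; rewrite !mxE vr col2.
Qed.

(** * The specialization point and the conclusion *)

Lemma pm_varsE (n : nat) (i : 'I_(2 * n)) (h : 'I_n) : i./2 = h ->
  pm_vars n i = if odd i then (var h)^-1 else var h.
Proof.
by rewrite /pm_vars => ih; have -> : Ordinal (ltn_half_ord i) = h by apply/val_inj.
Qed.

Lemma pm_vars_rowl (n : nat) (h : 'I_n) : pm_vars n (row_order (lshift n h)) = var h.
Proof.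
have vE : row_order (lshift n h) = h.*2 :> nat by rewrite /= ltn_ord mul2n.
by rewrite (@pm_varsE _ _ h) vE ?doubleK // odd_double.
Qed.

Lemma pm_vars_rowr (n : nat) (h : 'I_n) :
  pm_vars n (row_order (rshift n h)) = (var h)^-1.
Proof.
have vE : row_order (rshift n h) = h.*2.+1 :> nat by rewrite /=; case: ifP; lia.
by rewrite (@pm_varsE _ _ h) vE /= ?odd_double ?uphalf_double.
Qed.

Lemma pm_vars_inj (n : nat) : injective (pm_vars n).
Proof.
have vv (i j : 'I_n) : var i != (var j)^-1.
  apply/eqP => E; have : var i * var j == 1 by rewrite E mulVf ?var_neq0.
  rewrite -tofracM -mpolyXD -[1](tofrac1 {mpoly int[n]}) -mpolyX0 monom_eq.
  by move/eqP/mnmP/(_ i); rewrite mnmDE mnm0E mnm1E eqxx.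
move=> i j; rewrite /pm_vars => E; apply/val_inj => /=.
have {E}[ij ij2] : odd i = odd j /\ i./2 = j./2.
  case: ifP E => oi; case: ifP => oj; last by move/var_inj/(congr1 val).
  - by move/invr_inj/var_inj/(congr1 val).
  - by move=> /esym/eqP; rewrite (negPf (vv _ _)).
  - by move/eqP; rewrite (negPf (vv _ _)).
by rewrite -[LHS]odd_double_half ij ij2 odd_double_half.
Qed.

Lemma ratfun_2_neq0 (n : nat) : 2%:R != 0 :> ratfun n.
Proof.
rewrite -(rmorph_nat (@tofrac {mpoly int[n]})) /= tofrac_eq0.
by rewrite -mpolyC_nat mpolyC_eq0.
Qed.

Lemma so_rect_mul_det (F : fieldType) (n m : nat) (v : 'I_n -> F) :
  (forall i, v i != 0) ->
  leval (so (rect n m n)) v * so_det (fun=> 0%N) v = so_det (fun=> m) v.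
Proof.
move=> v0; rewrite so_mul_det //; congr (\det _).
by apply/matrixP => h t; rewrite !mxE /rect ltn_ord.
Qed.

(** Only c and D are divided by; K and the sign u appear on both sides and need not be inverted. *)
Lemma sum_of_quotients (F : fieldType)
    (c K s u S1 S2 N1 N2 D X Y L1 L2 d1 d2 e1 e2 : F) :
  c != 0 -> D != 0 -> S1 * D = N1 -> S2 * D = N2 ->
  N1 + N2 = u * X -> D = u * Y ->
  c * X = s * K * (d2 * d1) -> c * Y = K * (e2 * e1) ->
  L1 * e1 = d1 -> L2 * e2 = d2 ->
  S1 + S2 = s * L1 * L2.
Proof.
move=> c0 D0 S1D S2D NE DE XE YE d1E d2E; apply: (mulIf D0); apply: (mulfI c0).
rewrite mulrDl S1D S2D NE DE mulrCA XE -d1E -d2E [c * _]mulrCA (mulrCA c) YE.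
by ring.
Qed.

Theorem theorem3 (m n : nat) (hn : (1 <= n)%N) :
  peval (schur (rect (2 * n) (2 * m + 1) n)) (pm_vars n)
    + peval (schur (rect (2 * n) (2 * m + 1) (n - 1))) (pm_vars n)
  = (-1) ^+ (m * n)
    * leval (so (rect n (m + 1) n)) (fun i => var i)
    * leval (so (rect n m n)) (fun i => - var i).
Proof.
have x0 := @var_neq0 n.
have [b [D0 D]] := alternant_rect_pm (@pm_vars_rowl n) (@pm_vars_rowr n).
have [K KE] := det_pm_block x0.
have c0 : (- 2%:R) ^+ n * (\prod_h @var n h) != 0.
  rewrite mulf_neq0 ?expf_neq0 ?oppr_eq0 ?ratfun_2_neq0 //.
  exact/prodf_neq0.
have nx0 (F : fieldType) (v : 'I_n -> F) :
  (forall i, v i != 0) -> forall i, - v i != 0 by move=> v0 i; rewrite oppr_eq0.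
(* The denominator is the case of empty partitions, where k = n-1; the numerators have k = m+n. *)
have E0 := KE n.-1 0 0 val val; rewrite mul0n mul1r in E0.
have E1 := KE (m + n)%N m (m + 1)%N (fun t => t.+1) val.
by apply: sum_of_quotients c0 (alternant0_neq0 (@pm_vars_inj n))
  (schur_mul_alternant _ _) (schur_mul_alternant _ _) (D m hn) D0
  (E1 _ _) (E0 _ _) (so_rect_mul_det (m + 1) x0) (so_rect_mul_det m (nx0 _ _ x0)) => t;
  have := ltn_ord t; rewrite /=; lia.
Qed.
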